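(* Let $A\in\mathbb{C}^{n\times n}$ be stable (all eigenvalues in the open left half-plane), let $B\in\mathbb{C}^{n\times r}$, and suppose $(A,B)$ is controllable. Let $X\in\mathbb{C}^{n\times n}$ solve the Lyapunov equation $AX+XA^*=-BB^*$, and let $s_1\ge s_2\ge\cdots\ge s_n>0$ be the singular values of $X$. Let $\omega_1\ge\omega_2\ge\cdots\ge\omega_n$ denote the eigenvalues of the Hermitian matrix $\tfrac12(A+A^* )$ (so $\omega_k$ is the $k$th rightmost). Then for all $k=1,\ldots,n$, $$\frac{s_k}{s_1}-1-\frac{\|B\|^2}{2s_1\|A\|}\;\le\;\frac{\omega_k}{\|A\|}\;\le\;1-\frac{s_{n-k+1}}{s_1}.$$
   Context: $\|\cdot\|$ denotes the vector 2-norm and the induced matrix (spectral) norm. $(A,B)$ controllable means the Krylov matrix $[B\ AB\ \cdots\ A^{n-1}B]$ has rank $n$. Under stability of $A$ and controllability of $(A,B)$, the solution $X$ of $AX+XA^*=-BB^*$ is unique and Hermitian positive definite, so its singular values equal its eigenvalues. *)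

(* Defs.v *)
(* Complex numbers: an arbitrary numClosedFieldType C
   (e.g. algC, or R[i] for a real closed field R). *)
From HB Require Import structures.
From mathcomp Require Import all_boot all_order all_algebra.
Set Implicit Arguments. Unset Strict Implicit. Unset Printing Implicit Defensive.
Import Order.TTheory GRing.Theory Num.Theory.
Local Open Scope ring_scope.

Section Defs.
Variable C : numClosedFieldType.

Definition ctrmx m n (A : 'M[C]_(m, n)) : 'M[C]_(n, m) := (map_mx Num.conj A)^T.

Definition vnorm n (x : 'cV[C]_n) : C := sqrtC (\sum_i `|x i 0| ^+ 2).

Definition is_opnorm m n (A : 'M[C]_(m, n)) (a : C) : Prop :=
  [/\ 0 <= a,
      (forall x : 'cV[C]_n, vnorm (A *m x) <= a * vnorm x)
    & (forall b, 0 <= b -> (forall x : 'cV[C]_n, vnorm (A *m x) <= b * vnorm x) -> a <= b)].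

Definition stable n (A : 'M[C]_n) : Prop :=
  forall l : C, eigenvalue A l -> 'Re l < 0.

Definition krylov n r (A : 'M[C]_n) (B : 'M[C]_(n, r)) : 'M[C]_(n, \sum_(k < n) r) :=
  @mxrow C n (fun _ : 'I_n => r) n (fun k : 'I_n => A ^+ k *m B).

Definition controllable n r (A : 'M[C]_n) (B : 'M[C]_(n, r)) : Prop :=
  \rank (krylov A B) = n.

Definition herm_eigs_desc n (H : 'M[C]_n) (w : 'I_n -> C) : Prop :=
  [/\ forall i, w i \is Num.real,
      forall i j : 'I_n, (i <= j)%N -> w j <= w i
    & char_poly H = \prod_(i < n) ('X - (w i)%:P)].

Definition sing_vals_desc n (X : 'M[C]_n) (s : 'I_n -> C) : Prop :=
  [/\ forall i, 0 <= s i,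
      forall i j : 'I_n, (i <= j)%N -> s j <= s i
    & char_poly (ctrmx X *m X) = \prod_(i < n) ('X - (s i ^+ 2)%:P)].

End Defs.

Definition ord0_of n (k : 'I_n) : 'I_n := Ordinal (leq_ltn_trans (leq0n k) (ltn_ord k)).

(* Main.v *)
Require Import Defs.
From HB Require Import structures.
From mathcomp Require Import all_boot all_order all_algebra.
From mathcomp Require Import perm ring.
Import Order.TTheory GRing.Theory Num.Theory.
Local Open Scope ring_scope.

(** Put [E = s_1 I - X], where [X] is Hermitian positive semidefinite. The
    Lyapunov equation reads [s_1 (A + A^H) = A E + E A^H - B B^H]. On the span of
    the eigenvectors of [X] for [s_1, ..., s_j] one has
    [|E x| <= (s_1 - s_j) |x|], so there the quadratic form of [A E + E A^H] is at
    most [2 |A| (s_1 - s_j) |x|^2] in absolute value. Evaluating the equation at a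
    nonzero vector common to such a span and to a span of extremal eigenvectors of
    [(A + A^H) / 2], which exists for dimension reasons, gives both bounds.

    That [X] is Hermitian is uniqueness for the Sylvester equation, and that it is
    positive semidefinite is an induction by Schur complements; both are done
    after a unitary triangularization of [A]. *)

Set Implicit Arguments.
Unset Strict Implicit.
Unset Printing Implicit Defensive.

Local Notation "M ^H" := (ctrmx M) (at level 8, format "M ^H").

(** * Factorization of split polynomials, similarity, and intersection of column spaces *)

Section FieldFacts.
Variable F : fieldType.

(** The head of [s] is a root of the right-hand product, hence occurs in [t], and its linear factor
    can be cancelled on both sides. *)
Lemma prod_XsubC_perm (s t : seq F) :
  \prod_(x <- s) ('X - x%:P) = \prod_(x <- t) ('X - x%:P) -> perm_eq s t.
Proof.
elim: s t => [|x s IHs] t.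
  move/(congr1 (fun p : {poly F} => size p)).
  by rewrite !size_prod_XsubC; case: t.
move=> eq_st; have x_t : x \in t.
  by rewrite -root_prod_XsubC -eq_st root_prod_XsubC mem_head.
have t_rem := perm_to_rem x_t; rewrite perm_sym (permPl t_rem) perm_cons perm_sym.
apply: IHs; move: eq_st; rewrite (perm_big _ t_rem) !big_cons.
by apply: mulfI; rewrite polyXsubC_eq0.
Qed.

(** Matches a prescribed eigenvalue family with the one that a spectral decomposition returns in an
    unspecified order. *)
Lemma prod_XsubC_reindex n (c d : 'I_n -> F) :
  \prod_i ('X - (c i)%:P) = \prod_i ('X - (d i)%:P) ->
  exists p : 'S_n, forall i, c i = d (p i).
Proof.
move=> eq_cd.
have prodE (f : 'I_n -> F) :
    \prod_(x <- [tuple f i | i < n]) ('X - x%:P) = \prod_i ('X - (f i)%:P).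
  by rewrite big_tuple; apply: eq_bigr => i _; rewrite tnth_mktuple.
have /tuple_permP[p cE] : perm_eq [tuple c i | i < n] [tuple d i | i < n].
  by apply: prod_XsubC_perm; rewrite !prodE.
exists p => i; have /(congr1 (fun t => tnth t i)) := val_inj cE.
by rewrite !tnth_mktuple.
Qed.

Lemma char_poly_conj n (P A : 'M[F]_n) :
  P \in unitmx -> char_poly (P *m A *m invmx P) = char_poly A.
Proof.
move=> uP; rewrite /char_poly /char_poly_mx.
have uPX : map_mx polyC P \in unitmx by rewrite map_unitmx.
have -> : 'X%:M - map_mx polyC (P *m A *m invmx P)
   = map_mx polyC P *m ('X%:M - map_mx polyC A) *m invmx (map_mx polyC P).
  rewrite mulmxBr mulmxBl scalar_mxC mulmxK // !map_mxM /= map_invmx //.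
by rewrite !det_mulmx mulrC mulrA -det_mulmx mulVmx // det1 mul1r.
Qed.

(** Grassmann's dimension formula, transposed because matrix spaces are row spaces. *)
Lemma col_spaces_meet n (S T : 'M[F]_n) : (n < \rank S + \rank T)%N ->
  exists2 x : 'cV[F]_n, x != 0 &
    (exists a, x = S *m a) /\ (exists b, x = T *m b).
Proof.
rewrite -mxrank_tr -[\rank T]mxrank_tr -mxrank_sum_cap => ltn.
have : (S^T :&: T^T)%MS != 0.
  rewrite -mxrank_eq0; apply: contraTneq ltn => ->.
  by rewrite addn0 -leqNgt rank_leq_col.
case/rowV0Pn => v; rewrite sub_capmx => /andP[/submxP[a va] /submxP[b vb]] v0.
exists v^T; first by rewrite -trmx0 (inj_eq trmx_inj).
split; [exists a^T; rewrite va | exists b^T; rewrite vb];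
  by rewrite trmx_mul trmxK.
Qed.

End FieldFacts.

(** * Conjugate transposes, squared norms and inner-product estimates *)

Section Hermitian.
Variable C : numClosedFieldType.

Lemma ctrmxE m n (A : 'M[C]_(m, n)) i j : A^H i j = (A j i)^*.
Proof. by rewrite !mxE. Qed.

Lemma ctrmx_conjt m n (A : 'M[C]_(m, n)) : A^H = map_mx Num.conj A^T.
Proof. by rewrite /ctrmx map_trmx. Qed.

Lemma ctrmxK m n (A : 'M[C]_(m, n)) : A^H^H = A.
Proof. by apply/matrixP => i j; rewrite !ctrmxE conjCK. Qed.

Lemma ctrmxM m n p (A : 'M[C]_(m, n)) (B : 'M[C]_(n, p)) :
  (A *m B)^H = B^H *m A^H.
Proof. by rewrite /ctrmx map_mxM trmx_mul. Qed.

Lemma ctrmxD m n (A B : 'M[C]_(m, n)) : (A + B)^H = A^H + B^H.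
Proof. by rewrite /ctrmx map_mxD linearD. Qed.

Lemma ctrmxN m n (A : 'M[C]_(m, n)) : (- A)^H = - A^H.
Proof. by rewrite /ctrmx map_mxN linearN. Qed.

Lemma ctrmxZ m n (a : C) (A : 'M[C]_(m, n)) : (a *: A)^H = a^* *: A^H.
Proof. by rewrite /ctrmx map_mxZ linearZ. Qed.

Lemma ctrmx0 m n : (0 : 'M[C]_(m, n))^H = 0.
Proof. by rewrite /ctrmx map_mx0 trmx0. Qed.

Lemma ctrmx_col m1 m2 n (A : 'M[C]_(m1, n)) (B : 'M[C]_(m2, n)) :
  (col_mx A B)^H = row_mx A^H B^H.
Proof. by rewrite /ctrmx map_col_mx tr_col_mx. Qed.

Lemma ctrmx_block m1 m2 n1 n2 (A : 'M[C]_(m1, n1)) (B : 'M[C]_(m1, n2))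
    (D : 'M[C]_(m2, n1)) (E : 'M[C]_(m2, n2)) :
  (block_mx A B D E)^H = block_mx A^H D^H B^H E^H.
Proof. by rewrite /ctrmx map_block_mx tr_block_mx. Qed.

Lemma unitarymx_ctr n (U : 'M[C]_n) : U \is unitarymx -> U *m U^H = 1%:M.
Proof. by rewrite ctrmx_conjt => /unitarymxP. Qed.

Lemma unitarymx_ctrl n (U : 'M[C]_n) : U \is unitarymx -> U^H *m U = 1%:M.
Proof. by move/unitarymx_ctr/mulmx1C. Qed.

Definition sqnorm n (x : 'cV[C]_n) : C := (x^H *m x) 0 0.

Lemma sqnormE n (x : 'cV[C]_n) : sqnorm x = \sum_i `|x i 0| ^+ 2.
Proof.
by rewrite /sqnorm mxE; apply: eq_bigr => i _; rewrite ctrmxE normCK mulrC.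
Qed.

Lemma sqnorm_ge0 n (x : 'cV[C]_n) : 0 <= sqnorm x.
Proof. by rewrite sqnormE sumr_ge0 // => i _; rewrite exprn_ge0. Qed.

Lemma sqnorm_eq0 n (x : 'cV[C]_n) : sqnorm x = 0 -> x = 0.
Proof.
rewrite sqnormE => /eqP; rewrite psumr_eq0 => [/allP x0|i _]; last first.
  exact: exprn_ge0.
apply/colP => i; rewrite mxE; apply/eqP.
by have := x0 i (mem_index_enum _); rewrite sqrf_eq0 normr_eq0.
Qed.

Lemma sqnorm_gt0 n (x : 'cV[C]_n) : x != 0 -> 0 < sqnorm x.
Proof.
by move=> x0; rewrite lt0r sqnorm_ge0 andbT; apply: contra_neq x0 => /sqnorm_eq0.
Qed.

Lemma sqnorm_unitary n (U : 'M[C]_n) (y : 'cV[C]_n) :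
  U \is unitarymx -> sqnorm (U *m y) = sqnorm y.
Proof.
by move=> uU; rewrite /sqnorm ctrmxM mulmxA -(mulmxA _ U^H) unitarymx_ctrl // mulmx1.
Qed.

Lemma sqnormZB n (c : C) (x y : 'cV[C]_n) : c \is Num.real ->
  sqnorm (c *: x - y) =
  c ^+ 2 * sqnorm x - c * ((x^H *m y) 0 0 + (y^H *m x) 0 0) + sqnorm y.
Proof.
move=> /CrealP cR; rewrite /sqnorm ctrmxD ctrmxN ctrmxZ cR.
rewrite mulmxBr !mulmxBl -!scalemxAl -!scalemxAr !scalerA -expr2.
rewrite ![(_ + _ : 'M_1) 0 0]mxE ![(- _ : 'M_1) 0 0]mxE.
rewrite ![(_ + _ : 'M_1) 0 0]mxE ![(- _ : 'M_1) 0 0]mxE.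
rewrite ![(_ *: _ : 'M_1) 0 0]mxE; ring.
Qed.

(** Stands in for Cauchy-Schwarz: expand 0 <= |c x - y|^2, bound |y|^2 by c^2 |x|^2 and divide by c.
    If c = 0, then y = 0. *)
Lemma inner_bound n (c : C) (x y : 'cV[C]_n) :
  0 <= c -> sqnorm y <= c ^+ 2 * sqnorm x ->
  (x^H *m y) 0 0 + (y^H *m x) 0 0 <= 2%:R * c * sqnorm x.
Proof.
rewrite le0r => /predU1P[->|c_gt0] le_y.
  have -> : y = 0.
    apply: sqnorm_eq0; apply/eqP; rewrite eq_le sqnorm_ge0 andbT.
    by rewrite (le_trans le_y) // expr0n mul0r.
  by rewrite ctrmx0 mul0mx mulmx0 !mxE addr0 mulr0 mul0r.
have := sqnorm_ge0 (c *: x - y); rewrite sqnormZB ?gtr0_real //.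
rewrite addrAC subr_ge0 => le_xy; rewrite -(ler_pM2l c_gt0).
apply: (le_trans le_xy); rewrite (le_trans (lerD (lexx _) le_y)) //.
by rewrite (_ : _ + _ = c * (2%:R * c * sqnorm x)) //; ring.
Qed.

Lemma opnorm_sqnorm m n (A : 'M[C]_(m, n)) a : is_opnorm A a ->
  forall x, sqnorm (A *m x) <= a ^+ 2 * sqnorm x.
Proof.
case=> a0 leA _ x; have := leA x; rewrite /vnorm -!sqnormE => le1.
rewrite -[sqnorm (A *m x)]sqrtCK -[sqnorm x]sqrtCK -exprMn.
by rewrite lerXn2r // nnegrE ?mulr_ge0 ?sqrtC_ge0 ?sqnorm_ge0.
Qed.

(** With z = B^H x and y = B z one has x^H y = |z|^2. Expanding 0 <= |b^2 x - y|^2 and using |y|^2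
    <= b^2 |z|^2 leaves b^2 |z|^2 <= b^4 |x|^2. If b = 0, then y = 0 and so |z|^2 = 0. *)
Lemma opnorm_ctr_sqnorm m n (B : 'M[C]_(m, n)) b : is_opnorm B b ->
  forall x, sqnorm (B^H *m x) <= b ^+ 2 * sqnorm x.
Proof.
move=> Bb x; have leB := opnorm_sqnorm Bb; have [b0 _ _] := Bb.
set z := B^H *m x; set y := B *m z.
have xy : (x^H *m y) 0 0 = sqnorm z.
  by rewrite /y /sqnorm mulmxA /z ctrmxM ctrmxK.
have yx : (y^H *m x) 0 0 = sqnorm z.
  by rewrite /y /sqnorm ctrmxM -mulmxA.
have := sqnorm_ge0 (b ^+ 2 *: x - y).
rewrite sqnormZB ?rpredX ?ger0_real // xy yx => h.
have := le_trans h (lerD (lexx _) (leB z)).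
rewrite mulrDr opprD addrA addrNK -exprM -mulrN.
move: b0; rewrite le0r => /predU1P[b0|b_gt0] {}h.
  have y0 : y = 0.
    apply: sqnorm_eq0; apply/eqP; rewrite eq_le sqnorm_ge0 andbT.
    by rewrite (le_trans (leB z)) // b0 expr0n mul0r.
  by rewrite -xy y0 mulmx0 mxE b0 expr0n mul0r.
rewrite -(@ler_pM2l _ (b ^+ 2)) ?exprn_gt0 // mulrA -expr2 -exprM.
by rewrite -subr_ge0 -mulrN.
Qed.

End Hermitian.

(** * Sylvester and Lyapunov equations with triangular coefficients *)

Section Lyapunov.
Variable C : numClosedFieldType.

Lemma addC_conj (a : C) : a + a^* = 2%:R * 'Re a.
Proof. by rewrite ReE; field. Qed.

Lemma add_conj_neq0 (a b : C) : 'Re a < 0 -> 'Re b < 0 -> a + b^* != 0.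
Proof.
move=> a0 b0; apply/eqP => /(congr1 (fun z => 'Re z)).
rewrite raddfD raddf0 /= Re_conj => /eqP; apply/negP.
by rewrite lt_eqF // -[0]addr0 ltrD.
Qed.

(* Since [T1] and [T2] are lower triangular, the [(i, j)] entry of the equation
   involves only entries [D k l] with [k <= i] and [l <= j], and [D i j] has
   coefficient [T1 i i + (T2 j j)^*]. *)
Lemma sylvester_trig_inj m n (T1 : 'M[C]_m) (T2 : 'M[C]_n) (D : 'M[C]_(m, n)) :
  is_trig_mx T1 -> is_trig_mx T2 ->
  (forall i j, T1 i i + (T2 j j)^* != 0) ->
  T1 *m D + D *m T2^H = 0 -> D = 0.
Proof.
move=> /is_trig_mxP trig1 /is_trig_mxP trig2 nz eqD.
(* Induction on i + j: among the off-diagonal terms, smaller indices vanish by induction and larger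
   ones by triangularity. *)
suff D0 N (i : 'I_m) (j : 'I_n) : (i + j < N)%N -> D i j = 0.
  by apply/matrixP => i j; rewrite mxE (D0 _ _ _ (ltnSn _)).
elim: N i j => // N IH i j; rewrite ltnS => leN.
have := congr1 (fun M : 'M_(m, n) => M i j) eqD; rewrite !mxE.
rewrite (bigD1 i) //= [X in _ + X + _]big1 => [|k ki]; last first.
  case: (ltngtP k i) => [ltk|gtk|/ord_inj eqk]; last by rewrite eqk eqxx in ki.
    by rewrite IH ?mulr0 // (leq_trans _ leN) // ltn_add2r.
  by rewrite trig1 // mul0r.
rewrite (bigD1 j) //= [X in _ + (_ + X)]big1 => [|k kj]; last first.
  case: (ltngtP k j) => [ltk|gtk|/ord_inj eqk]; last by rewrite eqk eqxx in kj.
    by rewrite IH ?mul0r // (leq_trans _ leN) // ltn_add2l.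
  by rewrite ctrmxE trig2 // conjC0 mulr0.
rewrite !addr0 ctrmxE mulrC -mulrDr => /eqP.
by rewrite mulf_eq0 (negPf (nz i j)) orbF => /eqP.
Qed.

Lemma gram_form m n (B : 'M[C]_(m, n)) (x : 'cV[C]_m) :
  (x^H *m (B *m B^H) *m x) 0 0 = sqnorm (B^H *m x).
Proof. by rewrite /sqnorm ctrmxM ctrmxK !mulmxA. Qed.

(* Induction on the size: splitting off the first coordinate, the Schur
   complement [Y] of the corner of [X] solves the Lyapunov equation for the
   trailing block of [A]. If the corner [xi] vanishes, so does the column below
   it, which makes the convention [xi^-1 = 0] harmless. *)
Lemma lyapunov_trig_psd n (A : 'M[C]_n) : is_trig_mx A ->
  (forall i, 'Re (A i i) < 0) -> forall r (B : 'M[C]_(n, r)) (X : 'M[C]_n),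
  X^H = X -> A *m X + X *m A^H = - (B *m B^H) ->
  forall x : 'cV[C]_n, 0 <= (x^H *m X *m x) 0 0.
Proof.
move=> Atrig; elim/trigsqmx_ind: A / Atrig => [|{}n mu c A Atrig IH] reA r B X hX.
  by move=> _ x; rewrite [x^H]thinmx0 !mul0mx mxE.
have remu : 'Re (mu 0 0) < 0.
  by have := reA (lshift n 0); rewrite block_mxEul.
have {}reA i : 'Re (A i i) < 0.
  by have := reA (rshift 1 i); rewrite block_mxEdr.
move: hX; rewrite -[X]submxK -[B]vsubmxK.
set xi := ulsubmx X; set x := dlsubmx X; set X1 := drsubmx X.
set b := usubmx B; set B1 := dsubmx B.
rewrite ctrmx_block => /eq_block_mx[hxi <- _ hX1].
rewrite ctrmx_block ctrmx_col ctrmx0 !mulmx_block mul_col_row.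
rewrite !mul0mx !mulmx0 !addr0 add_block_mx opp_block_mx.
case/eq_block_mx => eq_ul _ eq_dl eq_dr.
pose t := xi 0 0.
have xiE : xi = t%:M by exact: mx11_scalar.
have tR : t \is Num.real.
  by apply/CrealP; have := ctrmxE xi 0 0; rewrite hxi => <-.
(* The corner of the equation reads 2 Re(mu) t = - |b^H|^2, whence t >= 0. *)
have t_eq : (mu 0 0 + (mu 0 0)^* ) * t = - sqnorm b^H.
  have := congr1 (fun M : 'M_1 => M 0 0) eq_ul.
  rewrite /= /sqnorm ctrmxK xiE mul_mx_scalar mul_scalar_mx.
  rewrite -scalerDr [(_ *: _ : 'M_1) 0 0]mxE [(_ + _ : 'M_1) 0 0]mxE ctrmxE.
  by rewrite [(- _ : 'M_1) 0 0]mxE mulrC.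
have m_lt0 : mu 0 0 + (mu 0 0)^* < 0.
  by rewrite addC_conj pmulr_rlt0 // ltr0n.
have t_ge0 : 0 <= t.
  by rewrite -(nmulr_rle0 _ m_lt0) t_eq oppr_le0 sqnorm_ge0.
(* If t = 0 then b = 0, and the lower left block becomes a homogeneous Sylvester equation for
   [x]. *)
have x0 : t = 0 -> x = 0.
  move=> t0; have b0 : b^H = 0.
    by apply: sqnorm_eq0; apply/eqP; rewrite -oppr_eq0 -t_eq t0 mulr0.
  apply: (@sylvester_trig_inj _ _ A mu) => //; first exact: mx11_is_trig.
    by move=> i j; rewrite !ord1 add_conj_neq0.
  by move: eq_dl; rewrite xiE t0 raddf0 !mulmx0 add0r b0 mulmx0 oppr0.
(* Lets the factor t^-1 t be inserted next to [x] whether or not t vanishes. *)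
have tx : (t^-1 * t) *: x = x.
  by have [/x0->|t0] := eqVneq t 0; rewrite ?scaler0 // mulVf // scale1r.
have tVR : (t^-1)^* = t^-1 by apply/CrealP; rewrite rpredV.
have txH m (M : 'M_(m, 1)) : M *m x^H = (t^-1 * t) *: (M *m x^H).
  by rewrite scalemxAr -[_ *: x^H]ctrmxK ctrmxZ rmorphM /= tVR (CrealP tR) ctrmxK tx.
pose Y := X1 - t^-1 *: (x *m x^H).
have hY : Y^H = Y.
  rewrite /Y ctrmxD ctrmxN ctrmxZ hX1 ctrmxM ctrmxK.
  by rewrite tVR.
(* Correcting [B1] by t^-1 x b keeps the right-hand side a Gram matrix. The quadratic term of the
   correction balances because the corner equation gives b b^H = - (mu + conj mu) t. *)
have eqY : A *m Y + Y *m A^H =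
    - ((B1 - t^-1 *: x *m b) *m (B1 - t^-1 *: x *m b)^H).
  pose S := t^-1 *: (x *m x^H).
  have hS : S^H = S by rewrite ctrmxZ tVR ctrmxM ctrmxK.
  have xmu : x *m mu^H = (mu 0 0)^* *: x.
    by rewrite [mu^H]mx11_scalar ctrmxE mul_mx_scalar.
  have AS : A *m S = - (B1 *m b^H *m (t^-1 *: x)^H) - c *m x^H - (mu 0 0)^* *: S.
    rewrite /S -scalemxAr mulmxA.
    have -> : A *m x = - (B1 *m b^H) - t *: c - (mu 0 0)^* *: x.
      rewrite -eq_dl xiE mul_mx_scalar xmu; move: (A *m x) (t *: c) => M1 M2.
      by apply/matrixP => i j; rewrite !mxE; ring.
    rewrite !mulmxBl mulNmx !scalerBr -!scalemxAl !scalerA [t^-1 * _^*]mulrC.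
    by rewrite ctrmxZ tVR [c *m _ in RHS]txH -scalemxAr scalerN.
  have SA : S *m A^H = - (t^-1 *: x *m b *m B1^H) - x *m c^H - mu 0 0 *: S.
    rewrite -[S *m _]ctrmxK ctrmxM ctrmxK hS AS !ctrmxD !ctrmxN.
    rewrite [(_ *: S)^H]ctrmxZ conjCK hS.
    by rewrite !ctrmxM !ctrmxK mulmxA.
  have vbbv : t^-1 *: x *m b *m (b^H *m (t^-1 *: x)^H) =
      - ((mu 0 0 + (mu 0 0)^* ) *: S).
    rewrite mulmxA -[_ *m b *m _]mulmxA.
    have -> : b *m b^H = (- ((mu 0 0 + (mu 0 0)^* ) * t))%:M.
      by rewrite t_eq opprK /sqnorm ctrmxK -mx11_scalar.
    rewrite mul_mx_scalar scaleNr mulNmx -scalemxAl ctrmxZ tVR -scalemxAr.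
    by rewrite -scalemxAl /S [in RHS]txH !scalerA; congr (- (_ *: _)); ring.
  have AX1 : A *m X1 = - (B1 *m B1^H) - c *m x^H - x *m c^H - X1 *m A^H.
    rewrite -eq_dr; move: (c *m _) (A *m _) (x *m _) (X1 *m _) => M1 M2 M3 M4.
    by apply/matrixP => i j; rewrite !mxE; ring.
  rewrite /Y -/S mulmxBr mulmxBl AX1 AS SA ctrmxD ctrmxN ctrmxM.
  rewrite mulmxBr !mulmxBl vbbv.
  rewrite [B1 *m (_ *m _)]mulmxA; move: (B1 *m B1^H) (B1 *m b^H *m _) (_ *m b *m B1^H).
  move: (c *m _) (x *m _) (X1 *m _) {AS SA hS vbbv} S => M1 M2 M3 M4 M5 M6 M7.
  by apply/matrixP => i j; rewrite !mxE; ring.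
have Y_ge0 := IH reA _ _ _ hY eqY.
move=> z; rewrite -[z]vsubmxK ctrmx_col mul_row_block mul_row_col.
set z0 := usubmx z; set z1 := dsubmx z.
have X1E : X1 = Y + t^-1 *: (x *m x^H) by rewrite addrNK.
pose u := t *: z0 + x^H *m z1.
(* Completing the square in z0. *)
have -> : (z0^H *m xi + z1^H *m x) *m z0 + (z0^H *m x^H + z1^H *m X1) *m z1 =
    z1^H *m Y *m z1 + t^-1 *: (u^H *m u).
  rewrite X1E ctrmxD ctrmxZ (CrealP tR) ctrmxM ctrmxK xiE mul_mx_scalar.
  rewrite [z0^H *m x^H]txH !(mulmxDl, mulmxDr) -[in z1^H *m x *m z0]tx.
  rewrite -!(scalemxAl, scalemxAr) !mulmxA.
  move: (z0^H *m z0) (z1^H *m Y *m z1) (z0^H *m x^H *m z1) => M1 M2 M3.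
  move: (z1^H *m x *m x^H *m z1) (z1^H *m x *m z0) => M4 M5.
  by apply/matrixP => i j; rewrite !mxE; have [->|t0] := eqVneq t 0; [ring|field].
rewrite mxE addr_ge0 ?Y_ge0 // mxE mulr_ge0 ?invr_ge0 //.
exact: sqnorm_ge0.
Qed.

End Lyapunov.

(** * Symmetry and semidefiniteness of the solution for a general stable matrix *)

Section LyapunovSolution.
Variable C : numClosedFieldType.

Lemma stable_schur n (A : 'M[C]_n) : (0 < n)%N -> stable A ->
  exists2 P : 'M[C]_n, P \is unitarymx &
    is_trig_mx (P *m A *m P^H) /\ forall i, 'Re ((P *m A *m P^H) i i) < 0.
Proof.
move=> n_gt0 stA; have [P uP] := Schur A n_gt0.
rewrite /similar_to conjymx // -ctrmx_conjt => trigA.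
exists P => //; split=> // i; apply: stA.
rewrite eigenvalue_root_char -(char_poly_conj A (unitarymx_unit uP)).
rewrite invmx_unitary // -ctrmx_conjt char_poly_trig //.
rewrite -(big_map (fun j => (P *m A *m P^H) j j) predT (fun x => 'X - x%:P)).
by rewrite root_prod_XsubC; apply/mapP; exists i; rewrite ?mem_index_enum.
Qed.

(** X^H solves the same equation, so X^H - X solves the homogeneous one. In Schur coordinates its
    coefficients T_ii + conj T_jj have negative real part. *)
Lemma lyapunov_hermitian n r (A X : 'M[C]_n) (B : 'M[C]_(n, r)) :
  (0 < n)%N -> stable A -> A *m X + X *m A^H = - (B *m B^H) -> X^H = X.
Proof.
move=> n_gt0 /(stable_schur n_gt0)[P uP [trigT reT]] eqX.
have [PP PVP] := (unitarymx_ctr uP, unitarymx_ctrl uP).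
have eqD : A *m (X^H - X) + (X^H - X) *m A^H = 0.
  have := congr1 (@ctrmx _ _ _) eqX.
  rewrite ctrmxN ctrmxD !ctrmxM !ctrmxK -eqX mulmxBr mulmxBl => eqXH.
  by rewrite addrACA -opprD [A *m X^H + _]addrC eqXH subrr.
have : P *m (X^H - X) *m P^H = 0.
  apply: (sylvester_trig_inj trigT trigT) => [i j|]; first exact: add_conj_neq0.
  rewrite !ctrmxM ctrmxK !mulmxA -[_ *m P^H *m P]mulmxA PVP mulmx1.
  rewrite -[_ *m P^H *m P]mulmxA PVP mulmx1 -mulmxDl -!mulmxA -mulmxDr.
  by rewrite eqD mulmx0 mul0mx.
move/(congr1 (fun M => P^H *m M *m P)); rewrite mulmx0 mul0mx !mulmxA PVP.
by rewrite mul1mx -mulmxA PVP mulmx1 => /eqP; rewrite subr_eq0 => /eqP.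
Qed.

(** In Schur coordinates [P *m X *m P^H] solves the equation with [P *m B]; its form at [P *m x] is
    that of [X] at [x]. *)
Lemma lyapunov_psd n r (A X : 'M[C]_n) (B : 'M[C]_(n, r)) :
  (0 < n)%N -> stable A -> A *m X + X *m A^H = - (B *m B^H) ->
  forall x : 'cV[C]_n, 0 <= (x^H *m X *m x) 0 0.
Proof.
move=> n_gt0 stA eqX x; have hX := lyapunov_hermitian n_gt0 stA eqX.
have [P uP [trigT reT]] := stable_schur n_gt0 stA.
have [PP PVP] := (unitarymx_ctr uP, unitarymx_ctrl uP).
have := lyapunov_trig_psd trigT reT (B := P *m B) (X := P *m X *m P^H).
rewrite !ctrmxM hX ctrmxK !mulmxA => /(_ erefl).
rewrite -[_ *m P^H *m P]mulmxA PVP mulmx1 -[_ *m P^H *m P]mulmxA PVP mulmx1.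
rewrite -mulmxDl -!mulmxA -mulmxDr !mulmxA eqX.
rewrite mulmxN mulNmx !mulmxA => /(_ erefl (P *m x)).
rewrite ctrmxM !mulmxA -[_ *m P^H *m P]mulmxA PVP mulmx1.
by rewrite -[_ *m P^H *m P]mulmxA PVP mulmx1.
Qed.

End LyapunovSolution.

(** * Unitary diagonalization with prescribed order, and spans of eigenvectors *)

Section SpectralBounds.
Variable C : numClosedFieldType.

Lemma char_poly_unitary_diag n (U : 'M[C]_n) (d : 'I_n -> C) :
  U \is unitarymx ->
  char_poly (U *m diag_mx (\row_i d i) *m U^H) = \prod_i ('X - (d i)%:P).
Proof.
move=> uU; rewrite ctrmx_conjt -invmx_unitary // char_poly_conj ?unitarymx_unit //.
rewrite char_poly_trig ?diag_mx_is_trig //.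
by apply: eq_bigr => i _; rewrite !mxE eqxx.
Qed.

Lemma hermitian_unitary_diag n (M : 'M[C]_n) : M^H = M ->
  exists U : 'M[C]_n, exists d : 'I_n -> C,
    U \is unitarymx /\ M = U *m diag_mx (\row_i d i) *m U^H.
Proof.
move=> hM; have /orthomx_spectralP : M \is normalmx.
  by apply/normalmxP; rewrite -ctrmx_conjt hM.
have uP := spectral_unitarymx M; rewrite invmx_unitary // -ctrmx_conjt => eqM.
exists (spectralmx M)^H, (spectral_diag M 0); split.
  by rewrite ctrmx_conjt trmxC_unitary.
rewrite ctrmxK {1}eqM; congr (_ *m diag_mx _ *m _).
by apply/rowP => i; rewrite mxE.
Qed.

Lemma unitary_diag_perm n (p : 'S_n) (U : 'M[C]_n) (d : 'I_n -> C) :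
  col_perm p U *m diag_mx (\row_i d (p i)) *m (col_perm p U)^H =
  U *m diag_mx (\row_i d i) *m U^H.
Proof.
apply/matrixP => i j; rewrite ![LHS]mxE ![RHS]mxE [RHS](reindex_inj (@perm_inj _ p)).
by apply: eq_bigr => k _; rewrite !mul_mx_diag !mxE.
Qed.

(** The case d = 1 of the preceding identity. *)
Lemma col_perm_unitary n (p : 'S_n) (U : 'M[C]_n) :
  U \is unitarymx -> col_perm p U \is unitarymx.
Proof.
move=> uU; have := unitary_diag_perm p U (fun=> 1).
have -> : diag_mx (\row_(i < n) (1 : C)) = 1%:M.
  by apply/matrixP => i j; rewrite !mxE.
rewrite !mulmx1 (unitarymx_ctr uU) => eq1.
by apply/unitarymxP; rewrite -ctrmx_conjt.
Qed.

Lemma herm_eigs_diag n (M : 'M[C]_n) (w : 'I_n -> C) :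
  M^H = M -> char_poly M = \prod_i ('X - (w i)%:P) ->
  exists2 U : 'M[C]_n, U \is unitarymx & M = U *m diag_mx (\row_i w i) *m U^H.
Proof.
move=> /hermitian_unitary_diag[U [d [uU ->]]]; rewrite char_poly_unitary_diag //.
case/esym/prod_XsubC_reindex => p wE; exists (col_perm p U).
  exact: col_perm_unitary.
rewrite -(unitary_diag_perm p); congr (_ *m diag_mx _ *m _).
by apply/rowP => i; rewrite !mxE wE.
Qed.

(** The eigenvalues d_i of X are nonnegative, and up to order their squares are those of the s_i;
    nonnegative numbers are determined by their squares. *)
Lemma psd_sing_vals_diag n (X : 'M[C]_n) (s : 'I_n -> C) :
  X^H = X -> (forall x : 'cV[C]_n, 0 <= (x^H *m X *m x) 0 0) ->
  sing_vals_desc X s ->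
  exists2 U : 'M[C]_n, U \is unitarymx & X = U *m diag_mx (\row_i s i) *m U^H.
Proof.
move=> hX psdX [s_ge0 _]; have [U [d [uU XE]]] := hermitian_unitary_diag hX.
have UU := unitarymx_ctrl uU.
(* d_i is the value of the form at the i-th column of [U]. *)
have d_ge0 i : 0 <= d i.
  have := psdX (U *m delta_mx i 0).
  rewrite XE ctrmxM !mulmxA -[_ *m U^H *m U]mulmxA UU mulmx1.
  rewrite -[_ *m U^H *m U]mulmxA UU mulmx1 mul_mx_diag -colE !mxE.
  by rewrite !eqxx conjC1 mul1r.
have -> : X^H *m X = U *m diag_mx (\row_i (d i ^+ 2)) *m U^H.
  rewrite hX {1 2}XE !mulmxA -[_ *m U^H *m U]mulmxA UU mulmx1.
  rewrite -[_ *m diag_mx _ *m diag_mx _]mulmxA mulmx_diag.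
  by congr (_ *m diag_mx _ *m _); apply/rowP => i; rewrite !mxE expr2.
rewrite char_poly_unitary_diag // => /esym/prod_XsubC_reindex[p sE].
exists (col_perm p U); first exact: col_perm_unitary.
rewrite XE -(unitary_diag_perm p); congr (_ *m diag_mx _ *m _).
apply/rowP => i; rewrite !mxE; apply/eqP.
by rewrite -(@eqrXn2 _ 2) ?sE.
Qed.

Lemma unitary_diag_form n (U : 'M[C]_n) (d : 'I_n -> C) (y : 'cV[C]_n) :
  U \is unitarymx ->
  ((U *m y)^H *m (U *m diag_mx (\row_i d i) *m U^H) *m (U *m y)) 0 0 =
  \sum_i d i * `|y i 0| ^+ 2.
Proof.
move=> uU; have UU := unitarymx_ctrl uU.
rewrite ctrmxM !mulmxA -[_ *m U^H *m U]mulmxA UU mulmx1.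
rewrite -[_ *m U^H *m U]mulmxA UU mulmx1 mul_mx_diag mxE.
by apply: eq_bigr => i _; rewrite !mxE normCK; ring.
Qed.

Lemma sqnorm_unitary_diag n (U : 'M[C]_n) (d : 'I_n -> C) (y : 'cV[C]_n) :
  U \is unitarymx ->
  sqnorm (U *m diag_mx (\row_i d i) *m U^H *m (U *m y)) =
  \sum_i `|d i| ^+ 2 * `|y i 0| ^+ 2.
Proof.
move=> uU; rewrite -!mulmxA [U^H *m _]mulmxA unitarymx_ctrl // mul1mx.
rewrite sqnorm_unitary // sqnormE mul_diag_mx.
by apply: eq_bigr => i _; rewrite !mxE normrM exprMn.
Qed.

Lemma pid_mx_support n m (a : 'cV[C]_n) (i : 'I_n) :
  (m <= i)%N -> (pid_mx m *m a) i 0 = 0.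
Proof.
by move=> le_mi; rewrite mxE big1 // => j _; rewrite mxE ltnNge le_mi andbF mul0r.
Qed.

Lemma copid_mx_support n m (a : 'cV[C]_n) (i : 'I_n) :
  (i < m)%N -> (copid_mx m *m a) i 0 = 0.
Proof.
move=> lt_im; rewrite mxE big1 // => j _.
by rewrite !mxE lt_im andbT -val_eqE subrr mul0r.
Qed.

(** Meant for [S] and [T] among [pid_mx m] and [copid_mx m], which select the first m columns of a
    unitary matrix or the remaining ones. *)
Lemma unitary_spaces_meet n (U V S T : 'M[C]_n) :
  U \is unitarymx -> V \is unitarymx -> (n < \rank S + \rank T)%N ->
  exists2 x : 'cV[C]_n, x != 0 &
    (exists a, x = U *m (S *m a)) /\ (exists b, x = V *m (T *m b)).
Proof.
move=> uU uV ltn; have /col_spaces_meet[x x0 [[a xa] [b xb]]] :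
    (n < \rank (U *m S) + \rank (V *m T))%N.
  by rewrite !eqmxMfull ?row_full_unit ?unitarymx_unit.
by exists x => //; split; [exists a | exists b]; rewrite mulmxA.
Qed.

End SpectralBounds.

(** * Quadratic form estimates on spans of eigenvectors, and the final inequalities *)

Section LyapunovBounds.
Variable C : numClosedFieldType.

(** The equation rewritten with E = a I - X and evaluated at x; here y = A E x, and E is Hermitian
    because a is real. *)
Lemma lyapunov_shifted_form n r (A X : 'M[C]_n) (B : 'M[C]_(n, r)) a
    (x : 'cV[C]_n) (y := A *m ((a%:M - X) *m x)) :
  a \is Num.real -> X^H = X -> A *m X + X *m A^H = - (B *m B^H) ->
  2%:R * a * (x^H *m (2%:R^-1 *: (A + A^H)) *m x) 0 0 =
  (x^H *m y) 0 0 + (y^H *m x) 0 0 - sqnorm (B^H *m x).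
Proof.
move=> /CrealP aR hX eqX; rewrite -gram_form -[B *m B^H]opprK -eqX /y.
rewrite !mulmxBl mul_scalar_mx !mulmxBr -!scalemxAr ctrmxD ctrmxN ctrmxZ aR.
rewrite !ctrmxM hX mulmxBl -!scalemxAl mulmxN mulNmx !(mulmxDl, mulmxDr) !mulmxA.
move: (x^H *m A *m x) (x^H *m A^H *m x) => M1 M2.
move: (x^H *m A *m X *m x) (x^H *m X *m A^H *m x) => M3 M4.
by rewrite !mxE; field.
Qed.

(** Only nonzero coordinates of [y] are constrained, so [U *m y] may range over a span of selected
    eigenvectors. *)
Lemma diag_form_ge n (U : 'M[C]_n) (d : 'I_n -> C) e (y : 'cV[C]_n) :
  U \is unitarymx -> (forall i, y i 0 != 0 -> e <= d i) ->
  e * sqnorm (U *m y) <=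
  ((U *m y)^H *m (U *m diag_mx (\row_i d i) *m U^H) *m (U *m y)) 0 0.
Proof.
move=> uU le_ed; rewrite unitary_diag_form // sqnorm_unitary // sqnormE mulr_sumr.
apply: ler_sum => i _; have [->|/le_ed le_i] := eqVneq (y i 0) 0.
  by rewrite normr0 expr0n !mulr0.
by rewrite ler_wpM2r // exprn_ge0.
Qed.

Lemma diag_form_le n (U : 'M[C]_n) (d : 'I_n -> C) e (y : 'cV[C]_n) :
  U \is unitarymx -> (forall i, y i 0 != 0 -> d i <= e) ->
  ((U *m y)^H *m (U *m diag_mx (\row_i d i) *m U^H) *m (U *m y)) 0 0 <=
  e * sqnorm (U *m y).
Proof.
move=> uU le_de; rewrite unitary_diag_form // sqnorm_unitary // sqnormE mulr_sumr.
apply: ler_sum => i _; have [->|/le_de le_i] := eqVneq (y i 0) 0.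
  by rewrite normr0 expr0n !mulr0.
by rewrite ler_wpM2r // exprn_ge0.
Qed.

Lemma shifted_diag_sqnorm_le n (U : 'M[C]_n) (s : 'I_n -> C) a e
    (y : 'cV[C]_n) : U \is unitarymx ->
  (forall i, y i 0 != 0 -> 0 <= a - s i <= e) ->
  sqnorm ((a%:M - U *m diag_mx (\row_i s i) *m U^H) *m (U *m y)) <=
  e ^+ 2 * sqnorm (U *m y).
Proof.
move=> uU le_e.
have -> : a%:M - U *m diag_mx (\row_i s i) *m U^H =
    U *m diag_mx (\row_i (a - s i)) *m U^H.
  have -> : diag_mx (\row_i (a - s i)) = a%:M - diag_mx (\row_i s i).
    by apply/matrixP => i j; rewrite !mxE mulrnBl.
  by rewrite mulmxBr mulmxBl mul_mx_scalar -scalemxAl unitarymx_ctr // scalemx1.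
rewrite sqnorm_unitary_diag // sqnorm_unitary // sqnormE mulr_sumr.
apply: ler_sum => i _; have [->|/le_e/andP[ge0 le_i]] := eqVneq (y i 0) 0.
  by rewrite normr0 expr0n !mulr0.
rewrite ler_wpM2r ?exprn_ge0 // ger0_norm //.
by rewrite lerXn2r // nnegrE (le_trans ge0).
Qed.

End LyapunovBounds.

Unset Implicit Arguments.

(* indices are 0-based: s k = s_{k+1}, w k = omega_{k+1}, s (ord0_of k) = s_1,
   s (rev_ord k) = s_{n-k} (0-based n-1-k) *)
Theorem theorem5p1 (C : numClosedFieldType) (n r : nat)
    (A : 'M[C]_n) (B : 'M[C]_(n, r)) (X : 'M[C]_n)
    (s w : 'I_n -> C) (nA nB : C) :
  stable A ->
  controllable A B ->
  A *m X + X *m ctrmx A = - (B *m ctrmx B) ->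
  sing_vals_desc X s ->
  herm_eigs_desc ((2%:R)^-1 *: (A + ctrmx A)) w ->
  is_opnorm A nA ->
  is_opnorm B nB ->
  forall k : 'I_n,
    s k / s (ord0_of k) - 1 - nB ^+ 2 / (2%:R * s (ord0_of k) * nA) <= w k / nA
    /\ w k / nA <= 1 - s (rev_ord k) / s (ord0_of k).
Proof.
move=> stA ctrlAB eqX svX [_ w_desc charH] opA opB k.
have n_gt0 : (0 < n)%N by rewrite (leq_ltn_trans _ (ltn_ord k)).
have hX := lyapunov_hermitian n_gt0 stA eqX.
have psdX := lyapunov_psd n_gt0 stA eqX.
have [V uV XE] := psd_sing_vals_diag hX psdX svX.
have [s_ge0 s_desc _] := svX; have [nA_ge0 _ _] := opA.
set a := s (ord0_of k); have s_le i : s i <= a by exact: s_desc.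
(* If s_1 = 0 then X = 0, so B B^H = 0 and B = 0; the Krylov matrix then has rank 0, against
   controllability and n > 0. *)
have a_gt0 : 0 < a.
  rewrite lt0r s_ge0 andbT; apply/eqP => a0; move: ctrlAB.
  have X0 : X = 0.
    rewrite XE (_ : diag_mx _ = 0) ?mulmx0 ?mul0mx //.
    apply/matrixP => i j; rewrite !mxE (_ : s i = 0) ?mul0rn //.
    by apply/eqP; rewrite eq_le s_ge0 andbT -a0.
  have B0 : B = 0.
    apply/matrixP => i j; rewrite [RHS]mxE.
    have : sqnorm (B^H *m delta_mx i 0) = 0.
      rewrite -gram_form -[B *m B^H]opprK -eqX X0 mulmx0 mul0mx addr0 oppr0.
      by rewrite mulmx0 mul0mx mxE.
    move/sqnorm_eq0/colP/(_ j); rewrite -colE !mxE.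
    by move/eqP; rewrite conjC_eq0 => /eqP.
  rewrite /controllable /krylov (_ : \mxrow_k0 _ = 0); last first.
    by rewrite -[RHS]mxrow0; apply: eq_mxrow => i; rewrite B0 mulmx0.
  by rewrite mxrank0 => n0; rewrite -n0 in n_gt0.
have aR : a \is Num.real by rewrite gtr0_real.
have two_gt0 : 0 < 2%:R :> C by rewrite ltr0n.
have hH : (2%:R^-1 *: (A + A^H))^H = 2%:R^-1 *: (A + A^H).
  rewrite ctrmxZ ctrmxD ctrmxK addrC; congr (_ *: _).
  by apply/CrealP; rewrite rpredV rpred_nat.
have [U uU HE] := herm_eigs_diag hH charH.
have AE_le e (x : 'cV[C]_n) : 0 <= e ->
    sqnorm ((a%:M - X) *m x) <= e ^+ 2 * sqnorm x ->
    sqnorm (A *m ((a%:M - X) *m x)) <= (nA * e) ^+ 2 * sqnorm x.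
  move=> e_ge0 leE; rewrite (le_trans (opnorm_sqnorm opA _)) // exprMn -[leRHS]mulrA.
  by rewrite ler_wpM2l ?exprn_ge0.
(* Test vector: the eigenvectors for the k+1 largest [w] meet those for the n-k largest [s], as the
   dimensions add up to n+1. The smallest of these [s] has 0-based index n-k-1, that is
   [rev_ord k]. *)
have upper : a * w k <= nA * (a - s (rev_ord k)).
  have e_ge0 : 0 <= a - s (rev_ord k) by rewrite subr_ge0.
  have /(unitary_spaces_meet uU uV)[x x0 [[y xy] [z xz]]] :
      (n < \rank (pid_mx k.+1 : 'M[C]_n) + \rank (pid_mx (n - k) : 'M[C]_n))%N.
    rewrite !rank_pid_mx ?leq_subr ?ltn_ord //.
    by rewrite addSn subnKC // ltnW // ltn_ord.
  have leE : sqnorm ((a%:M - X) *m x) <= (a - s (rev_ord k)) ^+ 2 * sqnorm x.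
    rewrite xz XE; apply: shifted_diag_sqnorm_le => // i zi.
    rewrite subr_ge0 s_le lerD2l lerN2 s_desc //= -ltnS subnSK ?ltn_ord //.
    by apply: contraR zi; rewrite -leqNgt => /pid_mx_support->.
  have := diag_form_ge (e := w k) uU (d := w) (y := pid_mx k.+1 *m y).
  rewrite -xy -HE => geH.
  rewrite -(ler_pM2l two_gt0) -(ler_pM2r (sqnorm_gt0 x0)) !mulrA.
  rewrite -[2%:R * a * _ * _]mulrA.
  apply: le_trans (ler_wpM2l _ (geH _)) _.
  - by rewrite mulr_ge0 ?ltW.
  - move=> i yi; apply: w_desc; rewrite leqNgt; apply: contra yi => lt_ki.
    by rewrite pid_mx_support.
  (* The term - |B^H x|^2 is nonpositive and is dropped. *)
  rewrite (lyapunov_shifted_form _ aR hX eqX) lerBlDr.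
  rewrite -[leLHS]addr0 lerD ?sqnorm_ge0 // -[2%:R * nA * _]mulrA.
  by rewrite inner_bound ?mulr_ge0 ?AE_le.
(* Test vector: the eigenvectors for the n-k smallest [w] meet those for the k+1 largest [s]. The
   B-term now has the unfavourable sign and costs |B|^2. *)
have lower : - (2%:R * (nA * (a - s k))) - nB ^+ 2 <= 2%:R * a * w k.
  have e_ge0 : 0 <= a - s k by rewrite subr_ge0.
  have /(unitary_spaces_meet uU uV)[x x0 [[y xy] [z xz]]] :
      (n < \rank (copid_mx k : 'M[C]_n) + \rank (pid_mx k.+1 : 'M[C]_n))%N.
    rewrite rank_pid_mx ?ltn_ord // rank_copid_mx; last exact/ltnW/ltn_ord.
    by rewrite addnS subnK // ltnW // ltn_ord.
  have leE : sqnorm ((a%:M - X) *m x) <= (a - s k) ^+ 2 * sqnorm x.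
    rewrite xz XE; apply: shifted_diag_sqnorm_le => // i zi.
    rewrite subr_ge0 s_le lerD2l lerN2 s_desc //= leqNgt.
    by apply: contra zi => lt_ki; rewrite pid_mx_support.
  have := diag_form_le (e := w k) uU (d := w) (y := copid_mx k *m y).
  rewrite -xy -HE => leH.
  rewrite -(ler_pM2r (sqnorm_gt0 x0)) -[2%:R * a * _ * _]mulrA.
  apply: le_trans (ler_wpM2l _ (leH _)).
  - rewrite (lyapunov_shifted_form _ aR hX eqX) mulrBl.
    rewrite lerD ?lerN2 ?opnorm_ctr_sqnorm // mulNr lerNl mulrA opprD.
    (* Applying the upper bound to - v yields the lower bound for v. *)
    set v := A *m _; have := @inner_bound _ _ (nA * (a - s k)) x (- v).
    rewrite ctrmxN mulmxN mulNmx [(- _ : 'M_1) 0 0]mxE [(- (v^H *m _) : 'M_1) 0 0]mxE.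
    rewrite mulrA; apply; first by rewrite mulr_ge0.
    by rewrite /sqnorm ctrmxN mulNmx mulmxN opprK; exact: AE_le.
  - by rewrite mulr_ge0 ?ltW.
  move=> i yi; apply: w_desc; rewrite leqNgt; apply: contra yi => lt_ik.
  by rewrite copid_mx_support.
(* If |A| = 0, the quotients by it are 0 by convention, and both claims reduce to s_i <= s_1. *)
have [nA0|nA_neq0] := eqVneq nA 0.
  by rewrite nA0 mulr0 invr0 !mulr0 subr0 subr_le0 subr_ge0 !ler_pdivrMr ?mul1r.
have nA_gt0 : 0 < nA by rewrite lt0r nA_neq0.
have [a_neq0 two_neq0] := (lt0r_neq0 a_gt0, lt0r_neq0 two_gt0).
split.
  rewrite (_ : _ - _ - _ = (- (2%:R * (nA * (a - s k))) - nB ^+ 2) / (2%:R * a * nA)).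
    rewrite ler_pdivrMr ?mulr_gt0 // (_ : _ / _ * _ = 2%:R * a * w k) //.
    by field.
  by field; rewrite a_neq0 nA_neq0.
rewrite ler_pdivrMr // -(ler_pM2l a_gt0) (_ : _ * (_ * _) = nA * (a - s (rev_ord k))) //.
by field.
Qed.
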